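(* Let $k$ be a field with $\operatorname{char} k\neq 2$. (I) Let $V$ be a finite-dimensional vector space over $k$. Then strong symmetry does not depend on the choice of basis of $V$: if $r\in V\otimes V$ is strongly symmetric to one basis of $V$, then $r$ is strongly symmetric to every basis of $V$. (II) Let $\{e_1,e_2,e_3\}$ be a basis of a vector space $V$ over $k$, let $p,q,s,t,u,v,x,y,z\in k$, and let $$r= p(e_1\otimes e_2)+q(e_2\otimes e_1)+s(e_1\otimes e_3)+t(e_3\otimes e_1)+u(e_2\otimes e_3)+v(e_3\otimes e_2)+x(e_1\otimes e_1)+y(e_2\otimes e_2)+z(e_3\otimes e_3).$$ Then the following are equivalent: (1) $r$ is strongly symmetric; (2) $xy=p^2,\ xz=s^2,\ yz=u^2,\ xu=sp,\ ys=pu,\ zp=su,\ p=q,\ s=t,\ u=v$; (3) $xy=p^2,\ xz=s^2,\ yz=u^2,\ xu=sp,\ p=q,\ s=t,\ u=v$; (4) $xy=p^2,\ xz=s^2,\ yz=u^2,\ ys=up,\ p=q,\ s=t,\ u=v$; (5) $xy=p^2,\ xz=s^2,\ yz=u^2,\ zp=su,\ p=q,\ s=t,\ u=v$; (6) one of the following holds: (a) $z\neq 0$ and $r= z^{-1}su(e_1\otimes e_2)+z^{-1}su(e_2\otimes e_1)+s(e_1\otimes e_3)+s(e_3\otimes e_1)+u(e_2\otimes e_3)+u(e_3\otimes e_2)+z^{-1}s^2(e_1\otimes e_1)+z^{-1}u^2(e_2\otimes e_2)+z(e_3\otimes e_3)$; (b) $x\neq 0$ and $r=p(e_1\otimes e_2)+p(e_2\otimes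 e_1)+x(e_1\otimes e_1)+x^{-1}p^2(e_2\otimes e_2)$; (c) $r=y(e_2\otimes e_2)$.
   Context: Definition. Let $\{e_1,\dots,e_n\}$ be a basis of a vector space $V$ over $k$ and let $r=\sum_{i,j=1}^n k_{ij}(e_i\otimes e_j)\in V\otimes V$ with $k_{ij}\in k$. Then $r$ is called strongly symmetric to the basis $\{e_1,\dots,e_n\}$ if $k_{ij}=k_{ji}$ and $k_{ij}k_{lm}=k_{il}k_{jm}$ for all $i,j,l,m\in\{1,\dots,n\}$. In (II), ''strongly symmetric'' means strongly symmetric to $\{e_1,e_2,e_3\}$ (equivalently, by (I), to any basis). *)

(* Defs.v *)
From HB Require Import structures.
From mathcomp Require Import all_boot all_order all_algebra.

Set Implicit Arguments.
Unset Strict Implicit.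
Unset Printing Implicit Defensive.

Import GRing.Theory.
Local Open Scope ring_scope.

(* (T, tens) is a tensor product of U and V over k.  MathComp has no tensor
   product of vector spaces, so it is given by its universal property. *)
Definition is_tensor_product (k : fieldType) (U V T : lmodType k)
    (tens : {bilinear U -> V -> T}) : Prop :=
  forall (W : lmodType k) (b : {bilinear U -> V -> W}),
  exists g : {linear T -> W},
    (forall u v, g (tens u v) = b u v) /\
    (forall h : {linear T -> W}, (forall u v, h (tens u v) = b u v) -> h =1 g).

(* When e is a basis of V and (T, tens) is a tensor product, the matrix K of
   coordinates of r in the basis (e_i (x) e_j) exists and is unique, so that the
   existential quantifier only names it. *)
Definition strongly_symmetric (k : fieldType) (V T : lmodType k)
    (tens : {bilinear V -> V -> T}) (n : nat) (e : n.-tuple V) (r : T) : Prop :=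
  exists K : 'M[k]_n,
    [/\ r = \sum_(i < n) \sum_(j < n) K i j *: tens e`_i e`_j,
        forall i j : 'I_n, K i j = K j i
      & forall i j l m : 'I_n, K i j * K l m = K i l * K j m].

(* is_tensor_product is satisfiable: matrices model the tensor product of
   finite-dimensional spaces. *)
Section Existence.
Import VectorInternalTheory.
Variables (k : fieldType) (U V : vectType k).

Let T := 'M[k]_(dim U, dim V).
Let tens (u : U) (v : V) : T := (v2r u)^T *m v2r v.

Let tens_is_bilinear : bilinear_for *:%R *:%R tens.
Proof.
split=> w a x y; rewrite /tens linearP.
  by rewrite linearP mulmxDl -scalemxAl.
by rewrite mulmxDr -scalemxAr.
Qed.

HB.instance Definition _ :=
  bilinear_isBilinear.Build k U V T *:%R *:%R tens tens_is_bilinear.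

Let eU i : U := r2v (delta_mx 0 i).
Let eV j : V := r2v (delta_mx 0 j).

Let tens_delta i j : tens (eU i) (eV j) = delta_mx i j.
Proof. by rewrite /tens !r2vK trmx_delta mul_delta_mx. Qed.

Let decU u : u = \sum_i v2r u 0 i *: eU i.
Proof.
apply: (can_inj v2rK); rewrite linear_sum {1}[v2r u]row_sum_delta.
by apply: eq_bigr => i _; rewrite linearZ /= r2vK.
Qed.

Let decV v : v = \sum_j v2r v 0 j *: eV j.
Proof.
apply: (can_inj v2rK); rewrite linear_sum {1}[v2r v]row_sum_delta.
by apply: eq_bigr => j _; rewrite linearZ /= r2vK.
Qed.

Lemma tensor_product_exists :
  exists (T : lmodType k) (tens : {bilinear U -> V -> T}), is_tensor_product tens.
Proof.
exists T, tens => W b.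
pose g0 (M : T) := \sum_i \sum_j M i j *: b (eU i) (eV j).
have g0_lin : linear g0.
  move=> a M N; rewrite /g0 scaler_sumr -big_split; apply: eq_bigr => i _ /=.
  rewrite scaler_sumr -big_split; apply: eq_bigr => j _ /=.
  by rewrite !mxE scalerDl scalerA.
pose gL := GRing.isLinear.Build k T W _ g0 g0_lin.
pose g : {linear T -> W} := HB.pack g0 gL.
exists g; split=> [u v | h hP M].
  rewrite /= /g0 [in RHS](decU u) linear_sumlz; apply: eq_bigr => i _.
  rewrite [in RHS](decV v) linear_sumr; apply: eq_bigr => j _.
  by rewrite linearZl_LR linearZr_LR scalerA !mxE big_ord1 !mxE.
rewrite {1}[M]matrix_sum_delta linear_sum; apply: eq_bigr => i _.
rewrite linear_sum; apply: eq_bigr => j _.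
by rewrite linearZ -tens_delta hP.
Qed.

End Existence.

(* Main.v *)
Require Import Defs.
From HB Require Import structures.
From mathcomp Require Import all_boot all_order all_algebra.
From mathcomp Require Import ring.

Set Implicit Arguments.
Unset Strict Implicit.
Unset Printing Implicit Defensive.

Import GRing.Theory.
Local Open Scope ring_scope.

(** Write [r] as the sum of the [K i j *: (e_i (x) e_j)].

    For the independence of the basis, substituting [e_i = \sum_a A a i *: f_a]
    turns [K] into the matrix of the values [b (A_a) (A_b)], where
    [b x y = \sum_(i, j) x_i K_ij y_j] is the bilinear form of [K] and [A_a] is
    the row [a] of [A].  Strong symmetry of [K] says that [b] is symmetric
    and that [b x y * b z w = b x z * b y w] on basis vectors.  Both sides of
    the second identity are linear in each of the four vectors, so that it holds
    for all vectors, in particular for the rows of [A]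
    ([bform_strongly_symmetric], [strongly_symmetric_span]).

    For the list of equivalent conditions, the universal property of the tensor
    product shows that the [e_i (x) e_j] are linearly independent
    ([tensor_coordinates_inj]).  Hence the coefficients of [r] are the entries
    of the only possible [K], and condition (1) becomes a list of equations
    between products of two entries, which the symmetry of [K] reduces to
    condition (2) ([minors_of_strongly_symmetric3],
    [strongly_symmetric3_of_minors]).  The six quadratic equations in (2) say
    that the 2 x 2 minors of the symmetric matrix with diagonal [x], [y], [z]
    and off-diagonal entries [p], [s], [u] vanish.  If the three principal
    minors vanish, then the vanishing of one of the other three implies that of
    the remaining two: if the diagonal entry that occurs in it is nonzero, it
    can be cancelled, and if it is zero, then the two off-diagonal entries of
    its row vanish ([minors_of_pivot]).  Condition (6) solves the equations
    according to the first nonzero entry among [z] and [x]. *)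

(** * Change of basis *)

Section BilinearForm.
Variables (k : fieldType) (n : nat) (K : 'M[k]_n).

Definition bform (x y : 'I_n -> k) : k := \sum_i \sum_j x i * K i j * y j.

Lemma bform_sym : (forall i j, K i j = K j i) -> forall x y, bform x y = bform y x.
Proof.
move=> Ksym x y; rewrite /bform exchange_big; apply: eq_bigr => i _.
by apply: eq_bigr => j _; rewrite Ksym; ring.
Qed.

(** Both sides are quadruple sums with the same monomial in [x], [y], [z], [w]
    in front of [K i j * K l m] and [K i l * K j m] respectively. *)
Lemma bform_strongly_symmetric :
  (forall i j l m, K i j * K l m = K i l * K j m) ->
  forall x y z w, bform x y * bform z w = bform x z * bform y w.
Proof.
move=> Kss x y z w; rewrite /bform !mulr_suml; apply: eq_bigr => i _.
rewrite !big_distrlr exchange_big; apply: eq_bigr => l _ /=.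
under eq_bigr do rewrite mulr_sumr.
under [RHS]eq_bigr do rewrite mulr_sumr.
apply: eq_bigr => j _; apply: eq_bigr => m _; ring: (Kss i j l m).
Qed.
End BilinearForm.

Section ChangeOfBasis.
Variables (k : fieldType) (V : vectType k) (T : lmodType k).
Variable tens : {bilinear V -> V -> T}.

(** If [e_i = \sum_a A a i *: f_a], then the coefficient of [r] at [f_a (x) f_b] is
    the value at [(A a, A b)] of the bilinear form of the matrix of [r] in [e]. *)
Lemma strongly_symmetric_span (n m : nat) (e : n.-tuple V) (f : m.-tuple V) (r : T) :
  {subset e <= <<f>>%VS} ->
  strongly_symmetric tens e r -> strongly_symmetric tens f r.
Proof.
move=> ef [K [-> Ksym Kss]].
pose A (a : 'I_m) (i : 'I_n) := coord f a e`_i.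
exists (\matrix_(a, b) bform K (A a) (A b)); split=> [|a b|a b c d].
- transitivity (\sum_i \sum_j \sum_a \sum_b
                  (A a i * K i j * A b j) *: tens f`_a f`_b).
    apply: eq_bigr => i _; apply: eq_bigr => j _.
    have eE (l : 'I_n) : e`_l = \sum_a A a l *: f`_a.
      by apply: coord_span; apply/ef/mem_nth; rewrite size_tuple.
    rewrite {1}(eE i) linear_sumlz scaler_sumr; apply: eq_bigr => a _.
    rewrite (eE j) linear_sumr scaler_sumr; apply: eq_bigr => b _.
    rewrite linearZl_LR linearZr_LR /= !scalerA.
    by congr (_ *: _); ring.
  under eq_bigr do rewrite exchange_big.
  rewrite exchange_big; apply: eq_bigr => a _ /=.
  under eq_bigr do rewrite exchange_big.
  rewrite exchange_big; apply: eq_bigr => b _ /=.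
  rewrite mxE scaler_suml; apply: eq_bigr => i _.
  by rewrite scaler_suml.
- by rewrite !mxE bform_sym.
- by rewrite !mxE; apply: bform_strongly_symmetric.
Qed.
End ChangeOfBasis.

(** * Linear independence of the tensors of basis vectors *)

Section CoordinateForm.
Variables (k : fieldType) (V : vectType k) (n : nat) (e : n.-tuple V) (i j : 'I_n).

Definition coord2 (u v : V) : k^o := coord e i u * coord e j v.

Lemma coord2_is_bilinear : bilinear_for *:%R *:%R coord2.
Proof.
split=> w a u v; rewrite /coord2 linearP /=.
  by rewrite mulrDl -mulrA.
by rewrite mulrDr mulrCA.
Qed.

HB.instance Definition _ :=
  bilinear_isBilinear.Build k V V k^o *:%R *:%R coord2 coord2_is_bilinear.
End CoordinateForm.

(** The universal property turns the bilinear form [coord2 e i j] into a linear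
    form on [T] that takes a combination of the [e_a (x) e_b] to its coefficient
    at [e_i (x) e_j]. *)
Lemma tensor_coordinates_inj (k : fieldType) (V : vectType k) (T : lmodType k)
    (tens : {bilinear V -> V -> T}) (n : nat) (e : n.-tuple V) :
  is_tensor_product tens -> free e ->
  injective (fun K : 'M[k]_n => \sum_i \sum_j K i j *: tens e`_i e`_j).
Proof.
move=> tensP efree K L KL; apply/matrixP=> i j.
have [g [gE _]] := tensP _ (coord2 e i j : {bilinear V -> V -> k^o}).
have gK (M : 'M[k]_n) : g (\sum_a \sum_b M a b *: tens e`_a e`_b) = M i j.
  rewrite linear_sum (bigD1 i) //= [X in _ + X]big1 ?addr0 => [|a ai].
    rewrite linear_sum (bigD1 j) //= [X in _ + X]big1 ?addr0 => [|b bj].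
      by rewrite linearZ /= gE /= /coord2 !coord_free // !eqxx mulr1 [LHS]mulr1.
    rewrite linearZ /= gE /= /coord2 !coord_free //.
    by rewrite (negPf bj) mulr0 scaler0.
  rewrite linear_sum big1 // => b _.
  rewrite linearZ /= gE /= /coord2 !coord_free //.
  by rewrite (negPf ai) mul0r scaler0.
by rewrite -gK KL gK.
Qed.

(** * Dimension three *)

Section Dimension3.
Variables (k : fieldType).
Implicit Types p q s t u v x y z : k.

(** The arguments are in the order in which the coefficients of [r] are listed:
    pairs of opposite entries, then the diagonal. *)
Definition mx3 p q s t u v x y z : 'M[k]_3 :=
  \matrix_(i, j) (nth [::] [:: [:: x; p; s]; [:: q; y; u]; [:: t; v; z]] i)`_j.

Lemma sum_mx3 (V T : lmodType k) (b : {bilinear V -> V -> T}) (e1 e2 e3 : V)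
    p q s t u v x y z :
  \sum_i \sum_j mx3 p q s t u v x y z i j *:
                   b [tuple e1; e2; e3]`_i [tuple e1; e2; e3]`_j
  = p *: b e1 e2 + q *: b e2 e1 + s *: b e1 e3 + t *: b e3 e1
    + u *: b e2 e3 + v *: b e3 e2 + x *: b e1 e1 + y *: b e2 e2 + z *: b e3 e3.
Proof.
rewrite !big_ord_recl !big_ord0 !mxE /= !addr0 !addrA.
(* The double sum lists the entries row by row. *)
by rewrite [LHS](ACl (2*4*3*7*6*8*1*5*9)).
Qed.

Lemma strongly_symmetric3_of_minors (V T : lmodType k) (b : {bilinear V -> V -> T})
    (e1 e2 e3 : V) p s u x y z :
  [/\ x * y = p ^+ 2, x * z = s ^+ 2 & y * z = u ^+ 2] ->
  [/\ x * u = s * p, y * s = p * u & z * p = s * u] ->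
  strongly_symmetric b [tuple e1; e2; e3]
    (p *: b e1 e2 + p *: b e2 e1 + s *: b e1 e3 + s *: b e3 e1
     + u *: b e2 e3 + u *: b e3 e2 + x *: b e1 e1 + y *: b e2 e2 + z *: b e3 e3).
Proof.
move=> [xy xz yz] [xu ys zp].
(* Up to commutativity, each of the 81 identities is trivial or one of the
   six equations. *)
exists (mx3 p p s s u u x y z); split=> [|i j|i j l m]; first by rewrite sum_mx3.
  by case: i j => [[|[|[|?]]] ?] [[|[|[|?]]] ?] //; rewrite !mxE.
by case: i j l m => [[|[|[|?]]] ?] [[|[|[|?]]] ?] [[|[|[|?]]] ?] [[|[|[|?]]] ?] //;
  rewrite !mxE /=;
  first [ring | ring: xy | ring: xz | ring: yz | ring: xu | ring: ys | ring: zp].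
Qed.

Lemma minors_of_strongly_symmetric3 (V : vectType k) (T : lmodType k)
    (tens : {bilinear V -> V -> T}) (e1 e2 e3 : V) p q s t u v x y z :
  is_tensor_product tens -> free [:: e1; e2; e3] ->
  strongly_symmetric tens [tuple e1; e2; e3]
    (p *: tens e1 e2 + q *: tens e2 e1 + s *: tens e1 e3 + t *: tens e3 e1
     + u *: tens e2 e3 + v *: tens e3 e2
     + x *: tens e1 e1 + y *: tens e2 e2 + z *: tens e3 e3) ->
  [/\ x * y = p ^+ 2, x * z = s ^+ 2 & y * z = u ^+ 2]
  /\ [/\ x * u = s * p, y * s = p * u & z * p = s * u]
  /\ [/\ p = q, s = t & u = v].
Proof.
move=> tensP efree [K [rK Ksym Kss]].
have {rK} KE : K = mx3 p q s t u v x y z.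
  apply: (tensor_coordinates_inj (e := [tuple e1; e2; e3]) tensP efree).
  by rewrite /= sum_mx3 rK.
pose i1 : 'I_3 := 0; pose i2 : 'I_3 := 1; pose i3 : 'I_3 := 2%:R.
have pq := Ksym i1 i2; have st := Ksym i1 i3; have uv := Ksym i2 i3.
have xy := Kss i1 i1 i2 i2; have xz := Kss i1 i1 i3 i3; have yz := Kss i2 i2 i3 i3.
have xu := Kss i1 i1 i3 i2; have ys := Kss i2 i2 i1 i3; have zp := Kss i3 i3 i1 i2.
move: pq st uv xy xz yz xu ys zp; rewrite KE !mxE /= => <- <- <-.
by move=> xy xz yz xu ys zp; split; split.
Qed.

(** If [x != 0], both equations hold after multiplication by [x]; if [x = 0],
    then [p = s = 0] and all four products vanish.  Exchanging the basis
    vectors gives the same statement with [y] or [z] in the place of [x]. *)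
Lemma minors_of_pivot x y z p s u :
  x * y = p ^+ 2 -> x * z = s ^+ 2 -> x * u = s * p ->
  y * s = p * u /\ z * p = s * u.
Proof.
have [-> | x0 xy xz xu] := eqVneq x 0.
  rewrite !mul0r => /esym/eqP; rewrite sqrf_eq0 => /eqP->.
  by move=> /esym/eqP; rewrite sqrf_eq0 => /eqP->; rewrite !mulr0 !mul0r.
by split; apply: (mulfI x0); rewrite mulrA ?xy ?xz; ring: xu.
Qed.
End Dimension3.

Theorem lemma1p2 (k : fieldType) (char_k : 2%N \notin [pchar k]) :
  (forall (V : vectType k) (T : lmodType k) (tens : {bilinear V -> V -> T}),
     is_tensor_product tens ->
     forall (n m : nat) (e : n.-tuple V) (f : m.-tuple V),
       basis_of {:V} e -> basis_of {:V} f ->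
       forall r : T,
         strongly_symmetric tens e r -> strongly_symmetric tens f r)
  /\
  (forall (V : vectType k) (T : lmodType k) (tens : {bilinear V -> V -> T}),
     is_tensor_product tens ->
     forall e1 e2 e3 : V,
       basis_of {:V} [:: e1; e2; e3] ->
       forall (p q s t u v x y z : k) (r : T),
         r = p *: tens e1 e2 + q *: tens e2 e1
             + s *: tens e1 e3 + t *: tens e3 e1
             + u *: tens e2 e3 + v *: tens e3 e2
             + x *: tens e1 e1 + y *: tens e2 e2 + z *: tens e3 e3 ->
         [<-> strongly_symmetric tens [tuple e1; e2; e3] r;
              [/\ x * y = p ^+ 2, x * z = s ^+ 2 & y * z = u ^+ 2]
              /\ [/\ x * u = s * p, y * s = p * u & z * p = s * u]
              /\ [/\ p = q, s = t & u = v];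
              [/\ x * y = p ^+ 2, x * z = s ^+ 2 & y * z = u ^+ 2]
              /\ x * u = s * p
              /\ [/\ p = q, s = t & u = v];
              [/\ x * y = p ^+ 2, x * z = s ^+ 2 & y * z = u ^+ 2]
              /\ y * s = u * p
              /\ [/\ p = q, s = t & u = v];
              [/\ x * y = p ^+ 2, x * z = s ^+ 2 & y * z = u ^+ 2]
              /\ z * p = s * u
              /\ [/\ p = q, s = t & u = v];
              [\/ z != 0
                  /\ r = (z^-1 * s * u) *: tens e1 e2
                         + (z^-1 * s * u) *: tens e2 e1
                         + s *: tens e1 e3 + s *: tens e3 e1
                         + u *: tens e2 e3 + u *: tens e3 e2
                         + (z^-1 * s ^+ 2) *: tens e1 e1
                         + (z^-1 * u ^+ 2) *: tens e2 e2 + z *: tens e3 e3,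
                  x != 0
                  /\ r = p *: tens e1 e2 + p *: tens e2 e1
                         + x *: tens e1 e1 + (x^-1 * p ^+ 2) *: tens e2 e2
                | r = y *: tens e2 e2]]).
Proof.
split=> [V T tens _ n m e f _ /andP[/eqP fV _] r|V T tens tensP e1 e2 e3 be].
  by apply: strongly_symmetric_span => w _; rewrite fV memvf.
move=> p q s t u v x y z r rE; tfae.
- rewrite rE; exact: minors_of_strongly_symmetric3 (basis_free be).
- by move=> [minors [[]]].
- move=> [[xy xz yz] [xu pqstuv]]; split=> //; split=> //.
  by have [-> _] := minors_of_pivot xy xz xu; rewrite mulrC.
- move=> [[xy xz yz] [ys pqstuv]]; split=> //; split=> //.
  (* The exchange of e1 and e2 swaps x with y and s with u. *)
  have yx : y * x = p ^+ 2 by rewrite mulrC.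
  by have [_ ->] := minors_of_pivot yx yz ys; rewrite mulrC.
- move=> [[xy xz yz] [zp [pq st uv]]]; rewrite {}rE -{}pq -{}st -{}uv.
  have [z0 | z0] := eqVneq z 0.
    have s0 : s = 0 by apply/eqP; rewrite -sqrf_eq0 -xz z0 mulr0.
    have u0 : u = 0 by apply/eqP; rewrite -sqrf_eq0 -yz z0 mulr0.
    rewrite z0 s0 u0 !scale0r !addr0.
    have [x0 | x0] := eqVneq x 0.
      have p0 : p = 0 by apply/eqP; rewrite -sqrf_eq0 -xy x0 mul0r.
      by apply: Or33; rewrite x0 p0 !scale0r !add0r.
    by apply: Or32; split=> //; rewrite -xy mulKf.
  apply: Or31; split=> //.
  by rewrite -mulrA -zp -xz -yz (mulrC x) (mulrC y) !mulKf.
- case=> [[z0 ->] | [x0 ->] | ->].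
  + by apply: strongly_symmetric3_of_minors; split; field.
  + have := @strongly_symmetric3_of_minors k V T tens e1 e2 e3
      p 0 0 x (x^-1 * p ^+ 2) 0.
    rewrite !scale0r !addr0; apply.
      by split; field.
    by split; ring.
  + have := @strongly_symmetric3_of_minors k V T tens e1 e2 e3 0 0 0 0 y 0.
    by rewrite !scale0r !addr0 !add0r; apply; split; ring.
Qed.
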